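(* For every locally compact Hausdorff space $X$ there is a poset $P$ such that $X$ is homeomorphic to $\mathrm{MF}(P)$.
   Context: A poset is a set $P$ with a reflexive, antisymmetric, transitive relation $\preceq$. A filter on $P$ is a nonempty subset $F\subseteq P$ such that (1) for all $p,q\in F$ there is $r\in F$ with $r\preceq p$ and $r\preceq q$, and (2) if $p\in F$, $q\in P$ and $p\preceq q$ then $q\in F$. A filter is maximal if no strictly larger filter contains it. $\mathrm{MF}(P)$ is the set of maximal filters on $P$, with the topology having basis $\{N_p : p\in P\}$, where $N_p=\{F\in \mathrm{MF}(P) : p\in F\}$. *)

(* Defs.v *)
From HB Require Import structures.
From mathcomp Require Import all_boot all_order.
From mathcomp Require Import boolp classical_sets filter topology.

Set Implicit Arguments.
Unset Strict Implicit.
Unset Printing Implicit Defensive.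

Import Order.TTheory.
Local Open Scope classical_set_scope.
Local Open Scope order_scope.

(* Order filters on a poset, not to be confused with the set filters of the
   library ([Filter]). *)
Definition poset_filter {d : Order.disp_t} {P : porderType d} (F : set P) : Prop :=
  [/\ F !=set0,
      forall p q : P, F p -> F q -> exists r : P, [/\ F r, r <= p & r <= q] &
      forall p q : P, F p -> p <= q -> F q].

Definition maximal_poset_filter {d : Order.disp_t} {P : porderType d} (F : set P) : Prop :=
  poset_filter F /\ forall G : set P, poset_filter G -> ~ F `<` G.

Record MF {d : Order.disp_t} (P : porderType d) : Type := MkMF {
  MF_set :> set P;
  MF_maximal : maximal_poset_filter MF_set
}.

Definition MF_nbhd {d : Order.disp_t} {P : porderType d} (p : P) : set (MF P) :=
  [set F : MF P | (F : set P) p].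

HB.instance Definition _ (d : Order.disp_t) (P : porderType d) := gen_eqMixin (MF P).
HB.instance Definition _ (d : Order.disp_t) (P : porderType d) := gen_choiceMixin (MF P).

Lemma MF_base_cover {d : Order.disp_t} {P : porderType d} :
  \bigcup_(U in range (@MF_nbhd d P)) id U = [set: MF P].
Proof.
apply/seteqP; split=> // F _.
have [[[p Fp] _ _] _] := MF_maximal F.
by exists (MF_nbhd p) => //; exists p.
Qed.

Lemma MF_base_join {d : Order.disp_t} {P : porderType d} (U V : set (MF P)) (F : MF P) :
  range (@MF_nbhd d P) U -> range (@MF_nbhd d P) V -> id U F -> id V F ->
  exists W, [/\ range (@MF_nbhd d P) W, id W F & id W `<=` id U `&` id V].
Proof.
move=> [p _ <-] [q _ <-] /= Fp Fq.
have [[_ dirF _] _] := MF_maximal F.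
have [r [Fr rp rq]] := dirF p q Fp Fq.
exists (MF_nbhd r); split=> //; first by exists r.
move=> G /= Gr; have [[_ _ upG] _] := MF_maximal G.
by split; [exact: upG Gr rp | exact: upG Gr rq].
Qed.

(* The base is indexed by its own members because [isBaseTopological] wants a
   pointed index type, whereas P may be empty. *)
HB.instance Definition _ (d : Order.disp_t) (P : porderType d) :=
  isBaseTopological.Build (MF P) MF_base_cover MF_base_join.

Lemma MF_openE {d : Order.disp_t} {P : porderType d} (U : set (MF P)) :
  open U <-> exists A : set P, U = \bigcup_(p in A) MF_nbhd p.
Proof.
split=> [[D sD <-]|[A ->]].
  exists [set p | D (MF_nbhd p)]; apply/seteqP; split=> F /=.
    move=> [V DV VF]; have [p _ pV] := sD _ DV.
    by exists p; rewrite /= pV.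
  by move=> [p Dp Fp]; exists (MF_nbhd p).
exists (@MF_nbhd d P @` A); first by move=> _ [p _ <-]; exists p.
by rewrite bigcup_image.
Qed.

Definition homeomorphic (X Y : topologicalType) : Prop :=
  exists (f : X -> Y) (g : Y -> X),
    [/\ cancel f g, cancel g f, continuous f & continuous g].

(* Main.v *)
(* The poset consists of the nonempty relatively compact open sets of X, with
   U <= V iff U = V or closure U `<=` V.  By compactness a poset filter F has a
   point y in the closure of all its members, and y lies in every member that
   has a strictly smaller member in F.  If F has a least member U, any point of
   U lies in all members instead.  Either way F is contained in the filter N_x
   of the members containing some point x; so the maximal filters are exactly
   the N_x, and x |-> N_x is the homeomorphism. *)
From HB Require Import structures.
Require Import Defs.
From mathcomp Require Import all_boot all_order.
From mathcomp Require Import boolp classical_sets filter topology.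

Local Open Scope classical_set_scope.

(** Nonemptiness matters: the empty set would lie below everything, and the whole poset would then
    be the only maximal filter. *)
Record rc_open (X : topologicalType) : Type := RcOpen {
  rc_set :> set X;
  rc_openP : open rc_set;
  rc_nonempty : rc_set !=set0;
  rc_compact : compact (closure rc_set)
}.

HB.instance Definition _ (X : topologicalType) := gen_eqMixin (rc_open X).
HB.instance Definition _ (X : topologicalType) := gen_choiceMixin (rc_open X).

Lemma rc_open_inj (X : topologicalType) (U V : rc_open X) :
  U = V :> set X -> U = V.
Proof.
case: U V => [U oU nU cU] [V oV nV cV] /= eUV; subst V.
by congr RcOpen; exact: Prop_irrelevance.
Qed.

Definition rc_le (X : topologicalType) (U V : rc_open X) : bool :=
  `[< U = V \/ closure U `<=` V >].

Lemma rc_le_sub (X : topologicalType) (U V : rc_open X) : rc_le X U V -> U `<=` V.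
Proof.
by move=> /asboolP[-> //|UV]; apply: subset_trans UV; exact: subset_closure.
Qed.

Lemma rc_le_refl (X : topologicalType) : reflexive (rc_le X).
Proof. by move=> U; apply/asboolP; left. Qed.

Lemma rc_le_anti (X : topologicalType) : antisymmetric (rc_le X).
Proof.
by move=> U V /andP[/rc_le_sub UV /rc_le_sub VU]; apply: rc_open_inj; apply/seteqP.
Qed.

Lemma rc_le_trans (X : topologicalType) : transitive (rc_le X).
Proof.
move=> V U W /asboolP[-> //|UV] /rc_le_sub VW.
by apply/asboolP; right; exact: subset_trans VW.
Qed.

HB.instance Definition _ (X : topologicalType) :=
  Order.Le_isPOrder.Build (Order.Disp tt tt) (rc_open X)
    (@rc_le_refl X) (@rc_le_anti X) (@rc_le_trans X).

Lemma rc_leP (X : topologicalType) (U V : rc_open X) :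
  reflect (U = V \/ closure U `<=` V) (U <= V)%O.
Proof. exact: asboolP. Qed.

Definition rc_at (X : topologicalType) (x : X) : set (rc_open X) :=
  [set U | (U : set X) x].

(** Regularity inside a compact neighbourhood [K] of [x] gives a neighbourhood [B] whose closure
    lies in both [K] and [A]; the interior of [B] serves, its closure being closed in [K]. *)
Lemma rc_open_base (X : topologicalType) (x : X) (A : set X) :
  hausdorff_space X -> locally_compact [set: X] -> nbhs x A ->
  exists2 U : rc_open X, rc_at X x U & closure U `<=` A.
Proof.
move=> hX lX Ax; have [//|K] := lX x; rewrite withinET => Kx [cK clK].
have KAx : nbhs x (K `&` A) by exact: filterI.
have [B /nbhs_interior Bx BKA] := compact_regular hX cK Kx KAx.
have sBKA : closure (interior B) `<=` K `&` A.
  by apply: subset_trans BKA; apply: closureS; exact: interior_subset.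
have cB : compact (closure (interior B)).
  apply: subclosed_compact cK _; first exact: closed_closure.
  by apply: subset_trans sBKA _ => ? [].
have iBx : (interior B) x by exact: nbhs_singleton.
exists (RcOpen X (interior B) (open_interior B) (ex_intro _ x iBx) cB) => //.
by apply: subset_trans sBKA _ => ? [].
Qed.

Lemma rc_at_filter (X : topologicalType) (x : X) :
  hausdorff_space X -> locally_compact [set: X] -> poset_filter (rc_at X x).
Proof.
move=> hX lX; split.
- by have [U Ux _] := rc_open_base X x setT hX lX filterT; exists U.
- move=> U V Ux Vx; have UVx : nbhs x ((U : set X) `&` V).
    by apply: filterI; apply: open_nbhs_nbhs; split => //; exact: rc_openP.
  have [W Wx WUV] := rc_open_base X x _ hX lX UVx.
  by exists W; split => //; apply/rc_leP; right => y /WUV [].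
- by move=> U V Ux /rc_le_sub; apply.
Qed.

(** The members of [F] form a base of a proper set filter containing the compact set [closure U0],
    so this filter has a cluster point. *)
Lemma poset_filter_adherent (X : topologicalType) (F : set (rc_open X)) :
  poset_filter F -> exists y : X, forall U, F U -> closure U y.
Proof.
move=> [[U0 FU0] dirF _].
have fF : Filter (filter_from F (@rc_set X)).
  apply: filter_from_filter; first by exists U0.
  move=> U V FU FV; have [W [FW /rc_le_sub WU /rc_le_sub WV]] := dirF U V FU FV.
  by exists W => // y Wy; split; [exact: WU|exact: WV].
have pF : ProperFilter (filter_from F (@rc_set X)).
  by apply: filter_from_proper => U _; exact: rc_nonempty.
have [|y [_]] := rc_compact X U0 _ pF; first by exists U0 => //; exact: subset_closure.
by rewrite clusterE => Fy; exists y => U FU; apply: Fy; exists U.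
Qed.

Lemma poset_filter_sub_rc_at (X : topologicalType) (F : set (rc_open X)) :
  poset_filter F -> exists x : X, F `<=` rc_at X x.
Proof.
move=> fF; have [_ dirF _] := fF.
have [[U FU minU]|nomin] :=
    pselect (exists2 U, F U & forall V, F V -> (V <= U)%O -> V = U).
  (* A minimal member is least: by directedness some [W] in [F] lies below both [U] and [V], and
     minimality makes it [U]. *)
  have [x Ux] := rc_nonempty X U; exists x => V FV.
  have [W [FW WU WV]] := dirF U V FU FV.
  by rewrite (minU W FW WU) in WV; exact: rc_le_sub WV _ Ux.
have [y Fy] := poset_filter_adherent X F fF; exists y => U FU.
have [V [FV VU nVU]] : exists V, [/\ F V, (V <= U)%O & V <> U].
  apply: contrapT => noV; apply: nomin; exists U => // V FV VU.
  by apply: contrapT => nVU; apply: noV; exists V.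
(* As [V] differs from [U], the order gives [closure V] inside [U], and [y] lies in [closure V]. *)
by have /rc_leP[//|] := VU; apply; exact: Fy.
Qed.

(** Each neighbourhood of [x] contains a member around [x], which by the inclusion contains [y]; so
    [y] itself shows that the two points cannot be separated. *)
Lemma rc_at_sub_eq (X : topologicalType) (x y : X) :
  hausdorff_space X -> locally_compact [set: X] ->
  rc_at X x `<=` rc_at X y -> x = y.
Proof.
move=> hX lX xy; apply: (hX) => A B Ax By; exists y; split; last exact: nbhs_singleton.
have [U Ux UA] := rc_open_base X x A hX lX Ax.
by apply/UA/subset_closure; exact: xy.
Qed.

(** A larger filter is trapped between [rc_at X x] and some [rc_at X y], and then [x = y]. *)
Lemma rc_at_maximal (X : topologicalType) (x : X) :
  hausdorff_space X -> locally_compact [set: X] ->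
  maximal_poset_filter (rc_at X x).
Proof.
move=> hX lX; split=> [|G fG [xG]]; first exact: rc_at_filter.
have [y Gy] := poset_filter_sub_rc_at X G fG; apply.
by rewrite (rc_at_sub_eq X x y hX lX (subset_trans xG Gy)).
Qed.

Lemma maximal_poset_filter_rc_at (X : topologicalType) (F : set (rc_open X)) :
  hausdorff_space X -> locally_compact [set: X] ->
  maximal_poset_filter F -> exists x, F = rc_at X x.
Proof.
move=> hX lX [fF maxF]; have [x Fx] := poset_filter_sub_rc_at X F fF.
exists x; apply/seteqP; split=> //; apply: contrapT => xF.
by apply: (maxF (rc_at X x)); [exact: rc_at_filter|split].
Qed.

Lemma MF_inj (d : Order.disp_t) (P : porderType d) (F G : MF P) :
  MF_set F = MF_set G -> F = G.
Proof.
case: F G => [F mF] [G mG] /= eFG; subst G.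
by congr MkMF; exact: Prop_irrelevance.
Qed.

Theorem theorem2p2 (X : topologicalType) :
  hausdorff_space X -> locally_compact [set: X] ->
  exists (d : Order.disp_t) (P : porderType d), homeomorphic X (MF P).
Proof.
move=> hX lX; exists (Order.Disp tt tt), (rc_open X).
pose f (x : X) : MF (rc_open X) := MkMF (rc_at_maximal X x hX lX).
have surj (F : MF (rc_open X)) : {x | F = f x}.
  apply: cid; have [x Fx] := maximal_poset_filter_rc_at X F hX lX (MF_maximal F).
  by exists x; exact: MF_inj.
pose g F := sval (surj F).
have gK : cancel g f by move=> F; rewrite -(svalP (surj F)).
have fK : cancel f g.
  move=> x; apply/esym/(rc_at_sub_eq _ _ _ hX lX).
  by have := congr1 (@MF_set _ _) (gK (f x)) => /= ->.
exists f, g; split=> //; apply/continuousP => A.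
  move=> /MF_openE[D ->]; rewrite preimage_bigcup.
  (* The preimage of [MF_nbhd U] under [f] is [U] itself. *)
  by apply: bigcup_open => U _; exact: rc_openP.
(* Since [F = f (g F)], a member [U] is in [F] exactly when [g F] is in [U]; the members inside [A]
   cover [A], so their basic sets cover its preimage under [g]. *)
move=> oA; apply/MF_openE; exists [set U : rc_open X | U `<=` A].
apply/seteqP; split=> F /=.
  move=> Ag; have [U Ux UA] :=
    rc_open_base X (g F) A hX lX (open_nbhs_nbhs (conj oA Ag)).
  exists U; first by apply: subset_trans UA; exact: subset_closure.
  by rewrite /MF_nbhd /= -(gK F).
by move=> [U UA FU]; apply: UA; rewrite -(gK F) in FU.
Qed.
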